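(* One has $\limsup_{a\to\infty} n_a(a-1)/n_a=1$ and $\liminf_{a\to\infty} n_a(a-1)/n_a=0$. In particular, $\lim_{a\to\infty}n_a(a-1)/n_a$ does not exist.
   Context: $K$ is a field. For an integer $a\ge1$, $\mathcal I^1_{a,a}$ is the set of monomial ideals $I\subset K[x,y]$ that are generated by monomials of degree $a$ and contain $x^a$ and $y^a$. With $J=(x^a,y^a)$, the reduction number $r(I)$ of $I\in\mathcal I^1_{a,a}$ is the smallest integer $r\ge0$ with $I^{r+1}=JI^r$ (such $r$ exists). For $a\ge 2$, $n_a$ is the number of ideals in $\mathcal I^1_{a,a}$ whose minimal set of monomial generators has exactly $3$ elements, and $n_a(j)$ is the number of those among them with reduction number $j$. *)

(* Defs.v *)
From HB Require Import structures.
From mathcomp Require Import all_boot all_order all_algebra finmap.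
From mathcomp Require Import all_classical all_reals all_analysis.
From mathcomp Require mpoly.
(* The notations of mpoly clash with those of mathcomp-analysis; hence
   [mpoly 2 K] stands for {mpoly K[2]}, [mpolyX K m] for 'X_[K, m] and
   [mnm1 i] for U_(i). *)
Import -(notations) mpoly.
Import Order.TTheory GRing.Theory Num.Theory.
Import numFieldNormedType.Exports.

Set Implicit Arguments.
Unset Strict Implicit.
Unset Printing Implicit Defensive.

Local Open Scope classical_set_scope.
Local Open Scope ring_scope.

Section Ideals.
Variable A : comNzRingType.
Implicit Types I J S : set A.

(* The unit ideal is allowed, unlike with ssralg's [idealr_closed]. *)
Definition is_ideal I : Prop :=
  [/\ I 0, (forall f g, I f -> I g -> I (f + g))
         & (forall f g, I g -> I (f * g))].

Definition ideal_gen S : set A := smallest is_ideal S.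

Definition ideal_mul I J : set A := ideal_gen [set f * g | f in I & g in J].

Definition ideal_pow I (n : nat) : set A := iter n (ideal_mul I) setT.

Definition is_reduction_number J I (r : nat) : Prop :=
  ideal_pow I r.+1 = ideal_mul J (ideal_pow I r) /\
  forall s : nat, ideal_pow I s.+1 = ideal_mul J (ideal_pow I s) -> (r <= s)%N.

End Ideals.

Section MonomialIdeals.
Variable K : fieldType.

Definition varx : mpoly 2 K := mpolyX K (mnm1 ord0).
Definition vary : mpoly 2 K := mpolyX K (mnm1 ord_max).

Definition monomial_ideal (G : set (multinom 2)) : set (mpoly 2 K) :=
  ideal_gen [set mpolyX K m | m in G].

Definition I1 (a : nat) : set (set (mpoly 2 K)) :=
  [set I | (exists2 G : set (multinom 2),
              (forall m, G m -> mdeg m = a) & I = monomial_ideal G)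
           /\ I (varx ^+ a) /\ I (vary ^+ a)].

Definition Jxy (a : nat) : set (mpoly 2 K) :=
  ideal_gen [set varx ^+ a; vary ^+ a].

Definition is_min_monomial_gens (I : set (mpoly 2 K))
    (G : set (multinom 2)) : Prop :=
  I = monomial_ideal G /\
  forall H : set (multinom 2), H `<=` G -> I = monomial_ideal H -> H = G.

(* A monomial ideal has exactly one minimal set of monomial generators, so
   the existential below speaks about that set. *)
Definition three_generated (I : set (mpoly 2 K)) : Prop :=
  exists2 G : {fset multinom 2}, is_min_monomial_gens I [set` G] & #|` G| = 3%N.

(* [fset_set] is meaningful on finite sets only; [I1 a] is finite, because
   there are finitely many monomials of degree [a]. *)
Definition n_ideals (a : nat) : nat :=
  #|` fset_set [set I | I1 a I /\ three_generated I]|.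

Definition n_ideals_red (a j : nat) : nat :=
  #|` fset_set [set I | (I1 a I /\ three_generated I)
                        /\ is_reduction_number (Jxy a) I j]|.

End MonomialIdeals.

(* The terms at [a < 2] are irrelevant to the limits (they are 0 / 0 = 0). *)
Definition red_ratio (R : realType) (K : fieldType) (a : nat) : R :=
  (n_ideals_red K a a.-1)%:R / (n_ideals K a)%:R.

(* Main.v *)
Require Import Defs.
From mathcomp Require Import all_boot all_order all_algebra finmap zify.
From mathcomp Require Import all_classical all_reals all_analysis.
From mathcomp Require mpoly.
Import -(notations) mpoly.
Import Order.TTheory GRing.Theory Num.Theory.
Import numFieldNormedType.Exports.
Set Implicit Arguments.
Unset Strict Implicit.
Unset Printing Implicit Defensive.
Local Open Scope classical_set_scope.
Local Open Scope ring_scope.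

(** An ideal of degree [a] that contains [x^a] and [y^a] and has three minimal
    generators is [I_b = (x^a, x^(a-b) y^b, y^a)] for exactly one [0 < b < a];
    hence [n_a = a - 1] ([n_idealsE]).

    Every power of [I_b] and every product [J I_b^r] is generated by monomials
    of one degree, and such an ideal determines its generating monomials, since
    a monomial divisible by another one of the same degree equals it
    ([monomial_ideal_inj]).  So [I_b^(r+1) = J I_b^r] is an equality of two
    sumsets of exponents, and it holds iff the middle generator to the power
    [r+1] has a second factorization, one that uses [x^a] or [y^a].  Cancelling
    the common copies of the middle generator, this means that [a] divides
    [t b] for some [1 <= t <= r+1] ([reduction_step]).  The least such [t] is
    [a / gcd(a, b)], so [r(I_b) = a / gcd(a, b) - 1], which is [a - 1] iff [b]
    is coprime to [a].  Therefore [n_a(a-1)] is Euler's [phi(a)]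
    ([n_ideals_redE]) and the ratio of the theorem is [phi(a) / (a - 1)].

    This ratio is at most 1, with equality at the primes, whence the limsup.
    For the liminf take [a = N!].  The integers [d u] with [1 <= d <= N] and
    [u] coprime to [a] are pairwise distinct, and each [d] contributes
    [phi(a) (a/d)] of them below [a^2]; so [phi(a)/a] times the [N]-th harmonic
    number is at most 1 ([totient_fact_series]), and the harmonic series
    diverges. *)

(** * Euler's totient *)

Lemma count_coprime_periods a k :
  (\sum_(0 <= u < k * a) coprime a u = k * totient a)%N.
Proof.
elim: k => [|k IHk]; first by rewrite !mul0n big_geq.
rewrite mulSn addnC (big_cat_nat (n := k * a)) ?leq_addr //= IHk mulSn addnC.
congr addn; rewrite -{1}[(k * a)%N]add0n big_addn addKn totient_count_coprime.
by apply: eq_bigr => u _; rewrite /coprime addnC gcdnMDl.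
Qed.

Lemma sum_multiples (F : nat -> nat) d m : (0 < d)%N ->
  (\sum_(0 <= n < d * m | d %| n) F (n %/ d) = \sum_(0 <= u < m) F u)%N.
Proof.
move=> d0; elim: m => [|m IHm]; first by rewrite muln0 !big_geq.
rewrite big_nat_recr //= -IHm mulnS addnC (big_cat_nat (n := d * m)) ?leq_addr //=.
congr addn; rewrite big_ltn_cond; last by rewrite -{1}[(d * m)%N]addn0 ltn_add2l.
rewrite dvdn_mulr // mulKn // big_nat_cond big1 ?addn0 // => n.
case/andP=> /andP[lt1 lt2] /dvdnP[q eqn]; move: lt1 lt2; rewrite eqn [(d * m)%N]mulnC.
by rewrite -mulSnr ltn_pmul2r // ltn_pmul2r //; lia.
Qed.

(** The left-hand side counts the pairs [(d, n)] with [n < a^2], [d] in [s]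
    dividing [n], and [n / d] coprime to [a].  No [n] occurs twice: if
    [d u = e v] with [d], [e] dividing [a] and [u], [v] coprime to [a], then [d]
    is coprime to [v], so [d] divides [e], and symmetrically. *)
Lemma totient_divisor_sum (a : nat) (s : seq nat) : (0 < a)%N -> uniq s ->
    (forall d, d \in s -> d %| a)%N ->
  (totient a * \sum_(d <- s) a %/ d <= a * a)%N.
Proof.
move=> a0 us sa.
have -> : (totient a * \sum_(d <- s) a %/ d =
    \sum_(0 <= n < a * a) \sum_(d <- s) (d %| n) && coprime a (n %/ d))%N.
  rewrite exchange_big big_distrr /=; apply: eq_big_seq => d /sa da.
  have d0 : (0 < d)%N by apply: dvdn_gt0 da.
  rewrite mulnC -count_coprime_periods -(sum_multiples _ _ d0) mulnA [(d * _)%N]mulnC.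
  by rewrite divnK // [in LHS]big_mkcond; apply: eq_bigr => n _; case: (d %| n)%N.
rewrite -[leqRHS]muln1 -{2}[(a * a)%N]subn0 -sum_nat_const_nat; apply: leq_sum => n _.
rewrite -big_mkcond sum1_count -size_filter.
have := filter_uniq (fun d => (d %| n)%N && coprime a (n %/ d)) us.
set t := [seq _ <- _ | _] => ut.
have tP d e : d \in t -> e \in t -> (d %| e)%N.
  rewrite !mem_filter => /andP[/andP[dn _] /sa da] /andP[/andP[en cop] _].
  rewrite -(@Gauss_dvdl _ _ (n %/ e)%N); first by rewrite mulnC divnK.
  exact: coprime_dvdl da cop.
case: t ut tP => [|d [|e t]] //= /and3P[]; rewrite !inE negb_or => /andP[/eqP de _] _ _ tP.
by case: de; apply/eqP; rewrite eqn_dvd !tP ?inE ?eqxx ?orbT.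
Qed.

(** Identifies the least positive [t] with [a] dividing [t * b]. *)
Lemma dvdn_mul_divgcd a b t : (0 < a)%N ->
  (a %| t * b)%N = (a %/ gcdn a b %| t)%N.
Proof.
move=> a0; have g0 : (0 < gcdn a b)%N by rewrite gcdn_gt0 a0.
have -> : (a %| t * b)%N =
    (a %/ gcdn a b * gcdn a b %| t * (b %/ gcdn a b) * gcdn a b)%N.
  by rewrite -mulnA !divnK ?dvdn_gcdl ?dvdn_gcdr.
rewrite dvdn_pmul2r //.
by rewrite Gauss_dvdl // /coprime -(eqn_pmul2r g0) muln_gcdl !divnK ?dvdn_gcdl ?dvdn_gcdr // mul1n.
Qed.

Lemma totient_leq_pred a : (1 < a)%N -> (totient a <= a.-1)%N.
Proof.
move=> a1; rewrite totient_count_coprime big_ltn; last by lia.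
rewrite /coprime gcdn0 eqn_leq [(a <= 1)%N]leqNgt a1 add0n -subn1 -[leqRHS]muln1 -sum_nat_const_nat.
by apply: leq_sum => i _; case: (_ == _).
Qed.

Section SmallTotientRatio.
Variable R : realType.

(** Every [d <= N] divides [N!], so the divisor sum of [N!] dominates
    [N!] times a harmonic number. *)
Lemma totient_fact_series N :
  (totient N`!)%:R * series harmonic N <= (N`!)%:R :> R.
Proof.
have f0 : (0 : R) < (N`!)%:R by rewrite ltr0n fact_gt0.
rewrite -(ler_pM2l f0) -natrM.
have /(_ (iota_uniq _ _)) := @totient_divisor_sum N`! (iota 1 N) (fact_gt0 N).
have div d : d \in iota 1 N -> (d %| N`!)%N.
  by rewrite mem_iota => H; apply: dvdn_fact; lia.
move=> /(_ div); rewrite -(ler_nat R); apply: le_trans.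
rewrite natrM natr_sum mulrCA ler_wpM2l ?ler0n // /series /= mulr_sumr.
rewrite /index_iota subn0 (iotaDl 1 0) big_map.
rewrite !big_seq; apply: ler_sum => i.
rewrite mem_iota add0n => /andP[_ iN].
have i0 : (i.+1%:R : R) != 0 by rewrite pnatr_eq0.
have di : (i.+1 %| N`!)%N by apply: div; rewrite mem_iota; lia.
by rewrite -{1}(divnK di) natrM mulfK.
Qed.

Lemma totient_ratio_small (e : R) n0 : 0 < e ->
  exists2 a, (n0 <= a)%N & (totient a)%:R / (a.-1)%:R <= e.
Proof.
move=> e0.
(* The factor 2 pays for replacing the denominator [N!] by [N! - 1]. *)
have [N n0N hN] : exists2 N, (n0 + 3 <= N)%N & 2 / e <= series (@harmonic R) N.
  apply: contrapT => H; apply: (@dvg_harmonic R).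
  have mono : nondecreasing_seq (series (@harmonic R)).
    by apply: nondecreasing_series => i _ _; exact: harmonic_ge0.
  apply: nondecreasing_is_cvgn => //.
  exists (2 / e) => _ [N _ <-]; rewrite leNgt; apply/negP => lt.
  apply: H; exists (n0 + 3 + N)%N; first exact: leq_addr.
  by apply: le_trans (ltW lt) (mono _ _ _); exact: leq_addl.
exists N`!.
  by apply: (leq_trans _ (fact_geq N)); lia.
have N2 : (2 <= N`!)%N by apply: (leq_trans _ (fact_geq N)); lia.
have f0 : (0 : R) < (N`!.-1)%:R by rewrite ltr0n; lia.
rewrite ler_pdivrMr //.
have H := totient_fact_series N.
have t0 : (0 : R) <= (totient N`!)%:R by rewrite ler0n.
have : (totient N`!)%:R * (2 / e) <= (N`!)%:R.
  by apply: le_trans H; apply: ler_wpM2l.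
rewrite mulrA ler_pdivrMr // => H2.
have H3 : (N`!)%:R <= 2 * (N`!.-1)%:R :> R by rewrite -natrM ler_nat; lia.
rewrite -(ler_pM2l (ltr0Sn R 1)) mulrC (le_trans H2) // mulrC mulrCA ler_wpM2l //.
exact: ltW.
Qed.

End SmallTotientRatio.

(** * Upper and lower limits *)

Section LimSupInf.
Variable R : realType.
Local Open Scope ereal_scope.

(** An upper limit is an infimum, over the tails, of suprema: one tail bounded by
    [l] gives one inequality, a value at least [l] in each tail the other. *)
Lemma limn_esup_frequently (u : (\bar R)^nat) l :
  (\forall n \near \oo, u n <= l) -> (forall n0, exists2 n, (n0 <= n)%N & l <= u n) ->
  limn_esup u = l.
Proof.
move=> ul lu; rewrite /limn_esup limf_esupE; apply/eqP; rewrite eq_le; apply/andP; split.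
  apply: ge_ereal_inf; exists (ereal_sup (u @` [set n | u n <= l])).
    by exists [set n | u n <= l].
  by apply: ge_ereal_sup => _ [n unl <-].
apply: le_ereal_inf_tmp => _ [V [n0 _ n0V] <-].
have [n n0n lun] := lu n0.
by apply: le_trans lun (ereal_sup_ubound _); exists n => //; exact: n0V.
Qed.

Lemma limn_einf_frequently (u : (\bar R)^nat) (l : R) :
  (\forall n \near \oo, l%:E <= u n) ->
  (forall (e : R) n0, (0 < e)%R -> exists2 n, (n0 <= n)%N & u n <= (l + e)%:E) ->
  limn_einf u = l%:E.
Proof.
move=> lu ul; rewrite /limn_einf -/(limf_einf u \oo) limf_einfE; apply/eqP.
rewrite eq_le; apply/andP; split; last first.
  apply: le_ereal_sup_tmp; exists (ereal_inf (u @` [set n | l%:E <= u n])).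
    by exists [set n | l%:E <= u n].
  by apply: le_ereal_inf_tmp => _ [n unl <-].
apply: ge_ereal_sup => _ [V [n0 _ n0V] <-].
apply/lee_addgt0Pr => e e0.
have [n n0n lun] := ul e n0 e0.
rewrite -EFinD; apply: le_trans (ereal_inf_lbound _) lun.
by exists n => //; exact: n0V.
Qed.
End LimSupInf.

(** * Products of ideals and monomial ideals *)

Section IdealArithmetic.
Variable A : comNzRingType.
Implicit Types I S T : set A.

Lemma ideal_gen_ideal S : is_ideal (ideal_gen S).
Proof.
split=> [I [[]] //|f g Sf Sg I HI|f g Sg I HI]; have [[_ ID IM] _] := HI.
- by apply: ID; [exact: Sf | exact: Sg].
- by apply: IM; exact: Sg.
Qed.

Lemma ideal_gen_sub S I : is_ideal I -> S `<=` I -> ideal_gen S `<=` I.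
Proof. by move=> II SI f; apply. Qed.

Lemma ideal_gen_mem S : S `<=` ideal_gen S.
Proof. by move=> f Sf I [_]; apply. Qed.

Lemma ideal_colon I g : is_ideal I -> is_ideal [set f | I (f * g)].
Proof.
move=> [I0 ID IM]; split=> /= [|f h|f h Ih].
- by rewrite mul0r.
- by rewrite mulrDl; exact: ID.
- by rewrite -mulrA; exact: IM.
Qed.

(** The elements that multiply into a fixed ideal form an ideal; this lets the
    two factors be reduced to generators one after the other. *)
Lemma ideal_mul_gen S T :
  ideal_mul (ideal_gen S) (ideal_gen T) = ideal_gen [set f * g | f in S & g in T].
Proof.
have ST := ideal_gen_ideal [set f * g | f in S & g in T].
apply/seteqP; split.
- apply: ideal_gen_sub => // _ [f Sf [g Tg <-]].
  suff: ideal_gen S `<=` [set f | ideal_gen [set f * g | f in S & g in T] (f * g)].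
    exact.
  apply: ideal_gen_sub; [exact: ideal_colon | move=> {}f {}Sf /=].
  rewrite mulrC; move: g Tg.
  apply: ideal_gen_sub; [exact: ideal_colon | move=> g Tg /=].
  by rewrite mulrC; apply: ideal_gen_mem; exists f => //; exists g.
- apply: ideal_gen_sub; first exact: ideal_gen_ideal.
  move=> _ [f Sf [g Tg <-]]; apply: ideal_gen_mem.
  by exists f; [exact: ideal_gen_mem | exists g => //; exact: ideal_gen_mem].
Qed.

End IdealArithmetic.

Section MonomialIdeals.
Variable K : fieldType.
Local Notation mon := (@monomial_ideal K).
Implicit Types G H : set (multinom 2).

Lemma monomial_ideal_mem G m : G m -> mon G (mpolyX K m).
Proof. by move=> Gm; apply: ideal_gen_mem; exists m. Qed.

(** The polynomials all of whose monomials are divisible by a member of [G] form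
    an ideal, which contains the generators. *)
Lemma monomial_ideal_dominated G m :
  mon G (mpolyX K m) -> exists2 m0, G m0 & lem m0 m.
Proof.
pose D (f : mpoly 2 K) := forall m1, m1 \in msupp f -> exists2 m0, G m0 & lem m0 m1.
suff GD : mon G `<=` D by move=> /GD; apply; rewrite msuppX mem_seq1.
apply: ideal_gen_sub; first split.
- by move=> m1; rewrite msupp0.
- by move=> f g Df Dg m1 /msuppD_le; rewrite mem_cat => /orP[/Df|/Dg].
- move=> f g Dg m1 /msuppM_le /allpairsP[[m2 m3] /= [_ /Dg[m0 Gm0 le03] ->]].
  by exists m0 => //; apply: lepm_trans le03 (lem_addl _ _).
- by move=> _ [m0 Gm0 <-] m1; rewrite msuppX mem_seq1 => /eqP ->; exists m0 => //; exact: lepm_refl.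
Qed.

Lemma lem_homog (m m' : multinom 2) : lem m m' -> mdeg m = mdeg m' -> m = m'.
Proof.
move=> le_mm' eqd; rewrite -(submK le_mm').
suff -> : mnm_sub m' m = mnm0 by rewrite add0m.
apply/eqP; rewrite -mdeg_eq0; apply/eqP; have := mdegD (mnm_sub m' m) m.
by rewrite submK // eqd; lia.
Qed.

Lemma monomial_ideal_inj d G H :
    (forall m, G m -> mdeg m = d) -> (forall m, H m -> mdeg m = d) ->
  mon G = mon H -> G = H.
Proof.
have sub G1 G2 : (forall m, G1 m -> mdeg m = d) -> (forall m, G2 m -> mdeg m = d) ->
    mon G1 = mon G2 -> G1 `<=` G2.
  move=> d1 d2 eq12 m Gm; have := monomial_ideal_mem Gm; rewrite eq12.
  case/monomial_ideal_dominated => m0 Hm0 /lem_homog <- //.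
  by rewrite (d1 _ Gm) (d2 _ Hm0).
by move=> dG dH eqGH; apply/seteqP; split; apply: sub.
Qed.

(** Each [m] in [G] is divisible by some [m0] in [H], which is in turn divisible
    by some [m1] in [G].  Degrees force [m1 = m], hence [m0 = m]; so [G] is
    contained in [H], and minimality of [H] gives equality. *)
Lemma min_monomial_gens_homog d G H :
    (forall m, G m -> mdeg m = d) -> is_min_monomial_gens (mon G) H -> G = H.
Proof.
move=> dG [eqGH minH]; apply: minH => // m Gm.
have := monomial_ideal_mem Gm; rewrite eqGH => /monomial_ideal_dominated[m0 Hm0 le0].
have := monomial_ideal_mem Hm0; rewrite -eqGH.
case/monomial_ideal_dominated => m1 Gm1 le1.
have m1m : m1 = m.
  by apply: lem_homog; [exact: lepm_trans le1 le0 | rewrite !dG].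
suff <- : m0 = m by [].
by apply/eqP; rewrite eq_le; apply/andP; split; apply: lem_leo; rewrite // -m1m.
Qed.

Definition madd G H : set (multinom 2) := [set mnm_add m m' | m in G & m' in H].

Definition mtimes G n := iter n (madd G) [set mnm0].

Lemma monomial_idealM G H : ideal_mul (mon G) (mon H) = mon (madd G H).
Proof.
rewrite /monomial_ideal ideal_mul_gen; congr ideal_gen; apply/seteqP; split.
- move=> _ [_ [m Gm <-] [_ [m' Hm' <-] <-]].
  by exists (mnm_add m m'); [exists m => //; exists m' | rewrite mpolyXD].
- move=> _ [_ [m Gm [m' Hm' <-]] <-]; exists (mpolyX K m); first by exists m.
  by exists (mpolyX K m'); [exists m' | rewrite mpolyXD].
Qed.

Lemma monomial_idealX G n : ideal_pow (mon G) n = mon (mtimes G n).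
Proof.
elim: n => [|n IHn]; last by rewrite /ideal_pow /= -/(ideal_pow _ _) IHn monomial_idealM.
apply/seteqP; split=> // f _; rewrite -[f]mulr1.
have [_ _ IM] := ideal_gen_ideal [set mpolyX K m | m in [set (mnm0 : multinom 2)]].
by apply: (IM f 1); apply: ideal_gen_mem; exists mnm0 => //; rewrite mpolyX0.
Qed.

(** * The three-generated ideals and their reduction numbers *)

Definition xy (i j : nat) : multinom 2 :=
  mnm_add (mnm_muln (mnm1 ord0) i) (mnm_muln (mnm1 ord_max) j).

Lemma xyE0 i j : xy i j ord0 = i.
Proof. by rewrite mnmDE !mulmnE !mnm1E mul1n mul0n addn0. Qed.

Lemma xyE1 i j : xy i j ord_max = j.
Proof. by rewrite mnmDE !mulmnE !mnm1E mul1n mul0n. Qed.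

Lemma mdeg_xy i j : mdeg (xy i j) = (i + j)%N.
Proof. by rewrite mdegD !mdegMn !mdeg1 !mul1n. Qed.

Lemma multinom2P (m : multinom 2) : m = xy (m ord0) (m ord_max).
Proof.
apply/mnmP => i; have [->|->] : i = ord0 \/ i = ord_max.
- by case: i => [[|[|//]] lti]; [left | right]; apply: val_inj.
- by rewrite xyE0.
- by rewrite xyE1.
Qed.

Lemma xy_inj i j k l : xy i j = xy k l -> i = k /\ j = l.
Proof.
move=> E; have := congr1 (fun m : multinom 2 => m ord0) E.
have := congr1 (fun m : multinom 2 => m ord_max) E.
by rewrite !xyE0 !xyE1 => -> ->.
Qed.

Lemma xyD i j k l : mnm_add (xy i j) (xy k l) = xy (i + k) (j + l).
Proof. by rewrite [LHS]multinom2P !(mnmDE _ (xy i j)) !xyE0 !xyE1. Qed.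

Lemma xy00 : xy 0 0 = mnm0.
Proof. by rewrite [RHS]multinom2P !mnm0E. Qed.

Definition ends a : set (multinom 2) := [set xy a 0; xy 0 a].
Definition gens3 a b : set (multinom 2) := [set xy a 0; xy (a - b) b; xy 0 a].

Lemma Jxy_monomial a : @Jxy K a = mon (ends a).
Proof.
rewrite /Jxy /monomial_ideal; congr ideal_gen.
by rewrite /ends image_setU !image_set1 /xy !mulm0n addm0 add0m -!mpolyXn.
Qed.

Lemma gens3_deg a b : (b <= a)%N -> forall m, gens3 a b m -> mdeg m = a.
Proof. by move=> ba m [[]|] ->; rewrite mdeg_xy ?subnK ?addn0. Qed.

Lemma ends_deg a m : ends a m -> mdeg m = a.
Proof. by move=> [] ->; rewrite mdeg_xy ?addn0. Qed.

Lemma madd_deg d e G H : (forall m, G m -> mdeg m = d) -> (forall m, H m -> mdeg m = e) ->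
  forall m, madd G H m -> mdeg m = (d + e)%N.
Proof. by move=> Gd He _ [m Gm [m' Hm' <-]]; rewrite mdegD Gd // He. Qed.

Lemma mtimes_deg d G n : (forall m, G m -> mdeg m = d) ->
  forall m, mtimes G n m -> mdeg m = (n * d)%N.
Proof.
move=> Gd; elim: n => [m ->|n IHn]; first by rewrite mdeg0.
by rewrite mulSn; apply: madd_deg.
Qed.

Lemma mtimes_gens3 a b n m : mtimes (gens3 a b) n m <->
  exists i j k, (i + j + k = n)%N /\ m = xy (a * i + (a - b) * j) (b * j + a * k).
Proof.
elim: n m => [|n IHn] m.
  split=> [-> |[i [j [k [E ->]]]]].
    by exists 0%N, 0%N, 0%N; rewrite !muln0 xy00.
  have [-> -> ->] : [/\ i = 0, j = 0 & k = 0]%N by split; lia.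
  by rewrite !muln0 xy00.
split.
  case=> m1 Gm1 [m2 /IHn[i [j [k [E ->]]]] <-].
  case: Gm1 => [[]|] ->; rewrite xyD.
  - by exists i.+1, j, k; split; [lia | congr xy; lia].
  - by exists i, j.+1, k; split; [lia | congr xy; lia].
  - by exists i, j, k.+1; split; [lia | congr xy; lia].
case=> [i [j [k [E ->]]]].
have step (i' j' k' : nat) (m1 : multinom 2) : (i' + j' + k' = n)%N ->
    gens3 a b m1 -> madd (gens3 a b) (mtimes (gens3 a b) n)
      (mnm_add m1 (xy (a * i' + (a - b) * j') (b * j' + a * k'))).
  move=> E' Gm1; exists m1 => //.
  by exists (xy (a * i' + (a - b) * j') (b * j' + a * k')) => //; apply/IHn; exists i', j', k'.
case: i E => [|i] E.
  case: j E => [|j] E.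
    case: k E => [//|k] E.
    have := step 0%N 0%N k (xy 0 a); rewrite xyD mulnS => H.
    by rewrite !(muln0, add0n) in H *; apply: H; [lia | right].
  have := step 0%N j k (xy (a - b) b); rewrite xyD !mulnS !muln0 !add0n addnA => H.
  by apply: H; [lia | left; right].
have := step i j k (xy a 0); rewrite xyD mulnS add0n addnA => H.
by apply: H; [lia | left; left].
Qed.

(** The forward direction reads off a factorization of the [r+1]-st power of the
    middle generator that uses an end generator; with [j] middle factors left,
    [t = r + 1 - j].  Conversely, if [t b = q a], then [t] copies of the middle
    generator can be traded for [t - q] copies of [x^a] and [q] copies of [y^a]. *)
Lemma reduction_step a b r : (0 < b < a)%N ->
  ideal_pow (mon (gens3 a b)) r.+1 = ideal_mul (@Jxy K a) (ideal_pow (mon (gens3 a b)) r)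
  <-> exists2 t, (0 < t <= r.+1)%N & (a %| t * b)%N.
Proof.
move=> /andP[b0 ba].
rewrite Jxy_monomial !monomial_idealX monomial_idealM.
have degG m : gens3 a b m -> mdeg m = a by apply: gens3_deg; exact: ltnW.
split.
- move/(@monomial_ideal_inj (r.+1 * a)%N) => E.
  have {E} E : mtimes (gens3 a b) r.+1 = madd (ends a) (mtimes (gens3 a b) r).
    apply: E; first exact: mtimes_deg.
    rewrite mulSn; apply: madd_deg; [exact: ends_deg | exact: mtimes_deg].
  have : mtimes (gens3 a b) r.+1 (xy ((a - b) * r.+1) (b * r.+1)).
    by apply/mtimes_gens3; exists 0%N, r.+1, 0%N; rewrite !muln0 !addn0.
  rewrite E => -[m1 H1 [m2 /mtimes_gens3[i [j [k [ijk ->]]]]]].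
  by case: H1 => ->; rewrite xyD => /xy_inj[E0 E1];
    exists (r.+1 - j)%N; [lia | | lia |]; apply/dvdnP;
    [exists k | exists k.+1]; rewrite mulnBl; lia.
- case=> t tr /dvdnP[q qE]; congr monomial_ideal; apply/seteqP; split; last first.
    move=> _ [m1 H1 [m2 H2 <-]]; exists m1; last by exists m2.
    by case: H1 => ->; [left; left | right].
  move=> m /mtimes_gens3[i [j [k [ijk ->]]]].
  (* Only the pure power of the middle generator has no end generator as a
     factor already. *)
  wlog: i j k ijk / (0 < i + k)%N => [W|ik0].
    have [ik0|] := posnP (i + k)%N; last exact: W.
    have [ -> -> jE] : [/\ i = 0, k = 0 & j = r.+1]%N by split; lia.
    have qt : (q < t)%N by nia.
    have := W (t - q)%N (r.+1 - t)%N q; rewrite !muln0 addn0 add0n jE.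
    have -> : (a * (t - q) + (a - b) * (r.+1 - t) = (a - b) * r.+1)%N.
      rewrite !mulnBr !mulnBl; nia.
    have -> : (b * (r.+1 - t) + a * q = b * r.+1)%N.
      rewrite !mulnBr; nia.
    by apply; lia.
  case: i ijk ik0 => [|i] ijk ik0.
    case: k ijk ik0 => // k ijk _.
    exists (xy 0 a); first by right.
    exists (xy (a * 0 + (a - b) * j) (b * j + a * k)).
      by apply/mtimes_gens3; exists 0%N, j, k; split; first lia.
    by rewrite xyD; congr xy; lia.
  exists (xy a 0); first by left.
  exists (xy (a * i + (a - b) * j) (b * j + a * k)).
    by apply/mtimes_gens3; exists i, j, k; split; first lia.
  by rewrite xyD; congr xy; lia.
Qed.

Lemma reduction_number_gens3 a b r : (0 < b < a)%N ->
  is_reduction_number (@Jxy K a) (mon (gens3 a b)) r <-> r.+1 = (a %/ gcdn a b)%N.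
Proof.
move=> ba; have a0 : (0 < a)%N by lia.
set q := (a %/ gcdn a b)%N.
have q0 : (0 < q)%N by rewrite divn_gt0 ?gcdn_gt0 ?a0 // dvdn_leq // dvdn_gcdl.
have stepP s : ideal_pow (mon (gens3 a b)) s.+1 =
    ideal_mul (@Jxy K a) (ideal_pow (mon (gens3 a b)) s) <-> (q <= s.+1)%N.
  rewrite reduction_step //; split=> [[t /andP[t0 ts]]|qs].
    by rewrite dvdn_mul_divgcd // => /(dvdn_leq t0) /leq_trans; apply.
  by exists q; [rewrite q0 | rewrite dvdn_mul_divgcd].
split=> [[/stepP qr minr]|rq].
  have : (r <= q.-1)%N by apply: minr; apply/stepP; rewrite prednK.
  by lia.
by split=> [|s]; rewrite stepP; lia.
Qed.

Lemma reduction_number_max a b : (0 < b < a)%N ->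
  is_reduction_number (@Jxy K a) (mon (gens3 a b)) a.-1 <-> coprime a b.
Proof.
move=> ba; rewrite reduction_number_gens3 // prednK; last by lia.
split=> [aE|/eqP ->]; last by rewrite divn1.
have := divnK (dvdn_gcdl a b); rewrite -aE => /eqP.
by rewrite -[X in _ == X]muln1 eqn_pmul2l; last by lia.
Qed.

Lemma varx_xy a : varx K ^+ a = mpolyX K (xy a 0).
Proof. by rewrite mpolyXn /xy mulm0n addm0. Qed.

Lemma vary_xy a : vary K ^+ a = mpolyX K (xy 0 a).
Proof. by rewrite mpolyXn /xy mulm0n add0m. Qed.

Lemma gens3_inj a b c : (0 < b < a)%N -> (0 < c < a)%N ->
  mon (gens3 a b) = mon (gens3 a c) -> b = c.
Proof.
move=> ba ca E; have ba' : (b <= a)%N by lia.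
have ca' : (c <= a)%N by lia.
have {}E := monomial_ideal_inj (gens3_deg ba') (gens3_deg ca') E.
have : gens3 a b (xy (a - b) b) by left; right.
by rewrite E => -[[]|] /xy_inj[]; lia.
Qed.

(** Degree [a] forces both pure powers to be generators, so one generator is
    left to choose; it has positive degree in both variables. *)
Lemma three_generated_I1 a : (0 < a)%N ->
  [set I | @I1 K a I /\ three_generated I] =
  (fun b => mon (gens3 a b)) @` [set b | (0 < b < a)%N].
Proof.
move=> a0; apply/seteqP; split.
- move=> _ [[[G Gd ->] [Ix Iy]] [H minH cardH]].
  have GH := min_monomial_gens_homog Gd minH.
  have mem m : mdeg m = a -> mon G (mpolyX K m) -> m \in H.
    move=> md /monomial_ideal_dominated[m0 Gm0 le0].
    have <- : m0 = m by apply: lem_homog le0 _; rewrite Gd.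
    by move: Gm0; rewrite GH.
  rewrite varx_xy in Ix; rewrite vary_xy in Iy.
  have xH : xy a 0 \in H by apply: mem Ix; rewrite mdeg_xy addn0.
  have yH : xy 0 a \in H by apply: mem Iy; rewrite mdeg_xy.
  have yx : xy 0 a != xy a 0 by apply/eqP => /xy_inj[]; lia.
  have := cardH; rewrite (cardfsD1 (xy a 0)) xH (cardfsD1 (xy 0 a)) !inE yx yH /=.
  rewrite !add1n => -[] /eqP /cardfs1P [m Em].
  have : m \in [fset m]%fset by rewrite inE.
  rewrite -Em !inE => /and3P[my mx mH].
  have md : mdeg m = a by apply: Gd; rewrite GH.
  move: my mx md mH Em; rewrite [m]multinom2P mdeg_xy.
  move: (m ord0) (m ord_max) => i j my mx ija mH Em.
  have j0 : j != 0%N by apply: contra mx => /eqP j0; rewrite j0 -ija j0 addn0.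
  have i0 : i != 0%N by apply: contra my => /eqP i0; rewrite i0 -ija i0.
  exists j; first by rewrite /=; lia.
  rewrite GH; congr monomial_ideal; rewrite /gens3 (_ : a - j = i)%N; last lia.
  apply/seteqP; split=> [n [[]|] -> //|n nH].
  have [->|nx] := eqVneq n (xy a 0); first by left; left.
  have [->|ny] := eqVneq n (xy 0 a); first by right.
  left; right; apply/eqP; rewrite -in_fset1 -Em !inE nx ny; exact: nH.
- move=> _ [b ba <-]; have ba' : (b <= a)%N by move: ba => /=; lia.
  have degG := gens3_deg ba'; split; first split.
  + by exists (gens3 a b).
  + by rewrite varx_xy vary_xy; split; apply: monomial_ideal_mem; [left; left | right].
  exists [fset xy a 0; xy (a - b) b; xy 0 a]%fset.
    have -> : [set` [fset xy a 0; xy (a - b) b; xy 0 a]%fset] = gens3 a b.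
      apply/seteqP; split=> m; rewrite /= !inE /gens3 /=.
        by move=> /orP[/orP[]|] /eqP ->; [left; left | left; right | right].
      by move=> [[]|] ->; rewrite eqxx ?orbT.
    split=> // H HG E; apply/esym/(monomial_ideal_inj degG _ E) => m /HG.
    exact: degG.
  have xyN i j k l : j != l -> xy i j != xy k l by apply: contra_neq => /xy_inj[].
  rewrite -fsetUA cardfsU1 cardfs2 !inE negb_or !xyN //; move: ba => /=; lia.
Qed.

Lemma card_image_gens3 a (P : pred nat) :
  #|` fset_set ((fun b => mon (gens3 a b)) @` [set b | (0 < b < a)%N /\ P b])| =
  count P (index_iota 1 a).
Proof.
pose s := [seq b <- index_iota 1 a | P b].
have sE : [set b | (0 < b < a)%N /\ P b] = [set` [fset b in s]%fset].
  apply/seteqP; split=> b; rewrite /= !inE mem_filter mem_index_iota.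
    by move=> [-> ->].
  by move=> /andP[-> ->].
rewrite sE fset_set_image; last exact: finite_fset.
rewrite set_fsetK card_in_imfset /=.
  by rewrite card_fseq undup_id ?size_filter // filter_uniq // iota_uniq.
move=> b c; rewrite !inE !mem_filter !mem_index_iota => /andP[_ ba] /andP[_ ca].
exact: gens3_inj.
Qed.

Lemma n_idealsE a : (0 < a)%N -> n_ideals K a = a.-1.
Proof.
move=> a0; rewrite /n_ideals three_generated_I1 //.
have := card_image_gens3 a xpredT; rewrite count_predT size_iota subn1 => <-.
congr #|` fset_set (_ @` _)|.
by apply/seteqP; split=> b; [move=> ? | move=> []].
Qed.

Lemma n_ideals_redE a : (1 < a)%N -> n_ideals_red K a a.-1 = totient a.
Proof.
move=> a1; have a0 : (0 < a)%N by lia.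
have -> : totient a = count (coprime a) (index_iota 1 a).
  rewrite totient_count_coprime big_ltn // /coprime gcdn0 eqn_leq [(a <= 1)%N]leqNgt a1 add0n.
  by rewrite -sum1_count [RHS]big_mkcond.
rewrite /n_ideals_red -card_image_gens3; congr #|` fset_set _|.
apply/seteqP; split=> I.
  have H := three_generated_I1 a0.
  move=> [HI]; have : [set I | @I1 K a I /\ three_generated I] I by [].
  by rewrite H => -[b ba <-] /reduction_number_max cop; exists b => //; split => //; apply: cop.
move=> [b [ba cop] <-]; split; last by apply/reduction_number_max.
have : ((fun b => mon (gens3 a b)) @` [set b | (0 < b < a)%N]) (mon (gens3 a b)) by exists b.
by rewrite -three_generated_I1.
Qed.

End MonomialIdeals.

(** * The ratio *)

Lemma red_ratioE (R : realType) (K : fieldType) a : (1 < a)%N ->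
  red_ratio R K a = (totient a)%:R / (a.-1)%:R.
Proof. by move=> a1; rewrite /red_ratio n_idealsE ?n_ideals_redE // ltnW. Qed.

Theorem proposition3p5 (R : realType) (K : fieldType) :
  [/\ limn_esup (fun a : nat => (red_ratio R K a)%:E) = 1%:E,
      limn_einf (fun a : nat => (red_ratio R K a)%:E) = 0%:E
    & ~ cvg (red_ratio R K a @[a --> \oo])].
Proof.
have sup1 : limn_esup (fun a : nat => (red_ratio R K a)%:E) = 1%:E.
  apply: limn_esup_frequently => [|n0].
    exists 2%N => // a /= a2; rewrite lee_fin red_ratioE //.
    by rewrite ler_pdivrMr ?mul1r ?ler_nat ?totient_leq_pred // ltr0n; lia.
  have [p n0p pp] := prime_above n0; exists p; first exact: ltnW.
  have p1 := prime_gt1 pp.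
  rewrite lee_fin red_ratioE // totient_prime // divff //.
  by rewrite pnatr_eq0; lia.
have inf0 : limn_einf (fun a : nat => (red_ratio R K a)%:E) = 0%:E.
  apply: limn_einf_frequently => [|e n0 e0].
    by near=> a; rewrite lee_fin divr_ge0.
  have [a n0a ae] := totient_ratio_small (n0 + 2)%N e0.
  exists a; first by apply: leq_trans n0a; lia.
  by rewrite lee_fin add0r red_ratioE //; lia.
split=> // cvg_u.
have /cvg_limn_einf_sup : (red_ratio R K a)%:E @[a --> \oo] -->
    (lim (red_ratio R K a @[a --> \oo]))%:E.
  by apply/fine_cvgP; split; [near=> a | exact: cvg_u].
rewrite sup1 inf0 => -[<- []] /eqP.
by rewrite oner_eq0.
Unshelve. all: by end_near.
Qed.
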